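(* For every $x>0$, the mapping $\alpha\mapsto E_\alpha(x^\alpha)$ is decreasing on $(0,2)$.
   Context: For $\alpha>0$, $E_\alpha$ denotes the Mittag-Leffler function $E_\alpha(z)=\sum_{n\ge 0} \frac{z^n}{\Gamma(1+n\alpha)}$, where $\Gamma$ is the Gamma function. *)

(* Defs.v *)
From Stdlib Require Import Reals.
From Coquelicot Require Import Coquelicot.
Open Scope R_scope.

Definition Gamma (s : R) : R :=
  RInt_gen (fun t => Rpower t (s - 1) * exp (- t))
           (at_right 0) (Rbar_locally p_infty).

Definition MittagLeffler (alpha z : R) : R :=
  Series (fun n : nat => z ^ n / Gamma (1 + INR n * alpha)).

(* Main.v *)
(* For [s > 1], [1/(1 - s^(-a))] is the sum of [s^(-na)], hence is [s] times the
   Laplace transform of [x |-> E_a (x^a)], and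
     [1/(1 - s^(-a)) - 1/(1 - s^(-b)) = (s^b - s^a) / ((s^a - 1)(s^b - 1))]
   is completely monotone: with [c = b - a], it equals
     [(s^c - 1)/(s^b - 1) * 1/(1 - s^(-a))]
   if [b <= 1], and
     [(s^c - 1)/(s - 1) * (s - 1)/(s^a - 1) * s^(-c)/(1 - s^(-b))]
   if [1 <= a] and [b <= 2].
   Taylor's formula controls all derivatives of [(s^c - 1)/(s - 1)] and
   [(s^a - 1)/(s - 1)], and [(s^c - 1)/(s^b - 1)] is the function
   [(u^(c/b) - 1)/(u - 1)] at the Bernstein function [u = s^b].  The Post-Widder
   inversion formula, which here reduces termwise to Euler's limit for [1/Gamma], then shows
   that [x |-> E_a (x^a) - E_b (x^b)] is nondecreasing; it is equivalent to
   [x^a / Gamma (1 + a)] at [0], hence positive. *)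

Require Import Defs.
From Stdlib Require Import Reals Factorial Lra Lia.
From Coquelicot Require Import Coquelicot.
Open Scope R_scope.

(** * Real powers and rising factorials *)

Lemma is_derive_Rpower (a s : R) : 0 < s ->
  is_derive (fun y => Rpower y a) s (a * Rpower s (a - 1)).
Proof.
  intros Hs.
  replace (a * Rpower s (a - 1)) with (a * / s * Rpower s a).
  - unfold Rpower. auto_derive; [exact Hs | ring].
  - unfold Rminus. rewrite Rpower_plus, Rpower_Ropp, Rpower_1 by exact Hs. ring.
Qed.

Lemma nonneg_derive_le (f df : R -> R) (u v : R) : u <= v ->
  (forall y, u <= y <= v -> is_derive f y (df y)) ->
  (forall y, u <= y <= v -> 0 <= df y) -> f u <= f v.
Proof.
  intros Huv Hd Hpos.
  destruct (MVT_gen f u v df) as [c [Hc He]].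
  - rewrite Rmin_left, Rmax_right by exact Huv. intros y Hy. apply Hd. lra.
  - rewrite Rmin_left, Rmax_right by exact Huv. intros y Hy.
    apply derivable_continuous_pt. exists (df y). apply is_derive_Reals, Hd, Hy.
  - rewrite Rmin_left, Rmax_right in Hc by exact Huv.
    pose proof (Hpos c Hc). nra.
Qed.

Lemma Rpower_gt_1 (s a : R) : 1 < s -> 0 < a -> 1 < Rpower s a.
Proof.
  intros Hs Ha. rewrite <- (Rpower_O s) by lra. apply Rpower_lt; assumption.
Qed.

(** The Pochhammer symbol [t (t + 1) ... (t + N - 1)]. *)
Fixpoint rising (t : R) (N : nat) : R :=
  match N with O => 1 | S k => rising t k * (t + INR k) end.

Lemma rising_shift (t : R) (N : nat) : rising t (S N) = t * rising (t + 1) N.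
Proof.
  induction N as [|N IH]; [simpl; ring|].
  change (rising t (S (S N))) with (rising t (S N) * (t + INR (S N))).
  rewrite IH, S_INR. simpl. ring.
Qed.

Lemma rising_pos (t : R) (N : nat) : 0 < t -> 0 < rising t N.
Proof.
  intros Ht. induction N as [|N IH]; simpl; [lra|].
  pose proof (pos_INR N). nra.
Qed.

Lemma rising_nonneg (t : R) (N : nat) : 0 <= t -> 0 <= rising t N.
Proof.
  intros Ht. induction N as [|N IH]; simpl; [lra|].
  pose proof (pos_INR N). nra.
Qed.

(** * Completely monotone functions *)

(** Complete monotonicity on (1, +oo), truncated at order [n]. The witness [g] is minus the
    derivative, so each level only asks for nonnegativity. Recursion on the order lets sums,
    products and compositions go by induction, without formulas for higher derivatives. *)
Fixpoint cm (n : nat) (f : R -> R) : Prop :=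
  match n with
  | O => forall s, 1 < s -> 0 <= f s
  | S k => (forall s, 1 < s -> 0 <= f s) /\
           exists g, (forall s, 1 < s -> is_derive f s (- g s)) /\ cm k g
  end.

Lemma locally_gt_1 (s : R) (P : R -> Prop) :
  1 < s -> (forall y, 1 < y -> P y) -> locally s P.
Proof.
  intros Hs HP. generalize (open_gt 1 s Hs). apply filter_imp. exact HP.
Qed.

Lemma cm_ext (n : nat) (f g : R -> R) :
  (forall s, 1 < s -> f s = g s) -> cm n f -> cm n g.
Proof.
  intros He. destruct n as [|n]; simpl.
  - intros Hf s Hs. rewrite <- He by exact Hs. now apply Hf.
  - intros [Hf [h [Hh Hc]]]. split.
    + intros s Hs. rewrite <- He by exact Hs. now apply Hf.
    + exists h. split; [|exact Hc]. intros s Hs.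
      apply (is_derive_ext_loc f); [|now apply Hh].
      now apply locally_gt_1.
Qed.

Lemma cm_weaken (n : nat) : forall f, cm (S n) f -> cm n f.
Proof.
  induction n as [|n IH]; intros f [Hf [g [Hg Hc]]]; [exact Hf|].
  split; [exact Hf|]. exists g. split; [exact Hg|]. now apply IH.
Qed.

Lemma cm_of_derivatives (d : nat -> R -> R) :
  (forall k s, 1 < s -> is_derive (d k) s (- d (S k) s)) ->
  (forall k s, 1 < s -> 0 <= d k s) -> forall n k, cm n (d k).
Proof.
  intros Hd Hp. induction n as [|n IH]; intros k.
  - exact (Hp k).
  - split; [exact (Hp k)|]. exists (d (S k)). split; [exact (Hd k)|apply IH].
Qed.

(** Derivatives are unique, so the existential witnesses inside [cm] agree on (1, +oo) with the
    explicit family [d]. This recovers the sign of a concrete derivative from closure properties of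
    [cm]. *)
Lemma cm_derivatives_nonneg (d : nat -> R -> R) :
  (forall k s, 1 < s -> is_derive (d k) s (- d (S k) s)) ->
  forall n k, cm n (d k) -> forall s, 1 < s -> 0 <= d (n + k)%nat s.
Proof.
  intros Hd. induction n as [|n IH]; intros k Hc.
  - exact Hc.
  - destruct Hc as [_ [g [Hg Hc]]].
    replace (S n + k)%nat with (n + S k)%nat by lia.
    apply IH. apply (cm_ext n g); [|exact Hc].
    intros s Hs.
    pose proof (is_derive_unique _ _ _ (Hg s Hs)) as E.
    rewrite (is_derive_unique _ _ _ (Hd k s Hs)) in E. lra.
Qed.

Lemma cm_const (n : nat) : forall c, 0 <= c -> cm n (fun _ => c).
Proof.
  induction n as [|n IH]; intros c Hc; simpl; [auto|].
  split; [auto|]. exists (fun _ => 0). split; [|apply IH; lra].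
  intros s _. rewrite Ropp_0. apply (is_derive_const c s).
Qed.

Lemma cm_plus (n : nat) : forall f g, cm n f -> cm n g -> cm n (fun s => f s + g s).
Proof.
  induction n as [|n IH]; simpl; intros f g.
  - intros Hf Hg s Hs. specialize (Hf s Hs). specialize (Hg s Hs). lra.
  - intros [Hf [f' [Df Cf]]] [Hg [g' [Dg Cg]]]. split.
    + intros s Hs. specialize (Hf s Hs). specialize (Hg s Hs). lra.
    + exists (fun s => f' s + g' s). split; [|now apply IH].
      intros s Hs. replace (- (f' s + g' s)) with (- f' s + - g' s) by ring.
      apply (is_derive_plus f g s (- f' s) (- g' s)); [now apply Df|now apply Dg].
Qed.

(** By the product rule the next function is [f' s * g s + f s * g' s]; the undifferentiated factors
    enter one order lower, hence [cm_weaken]. *)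
Lemma cm_mult (n : nat) : forall f g, cm n f -> cm n g -> cm n (fun s => f s * g s).
Proof.
  induction n as [|n IH]; intros f g Cf Cg.
  - intros s Hs. apply Rmult_le_pos; [now apply Cf|now apply Cg].
  - pose proof (cm_weaken n f Cf) as Wf. pose proof (cm_weaken n g Cg) as Wg.
    destruct Cf as [Hf [f' [Df Cf]]]. destruct Cg as [Hg [g' [Dg Cg]]]. split.
    + intros s Hs. apply Rmult_le_pos; [now apply Hf|now apply Hg].
    + exists (fun s => f' s * g s + f s * g' s). split.
      * intros s Hs.
        replace (- (f' s * g s + f s * g' s)) with (- f' s * g s + f s * - g' s) by ring.
        apply (is_derive_mult f g s (- f' s) (- g' s)); [now apply Df|now apply Dg|].
        intros; apply Rmult_comm.
      * apply cm_plus; now apply IH.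
Qed.

(** Chain rule: the next function is [f' (g s) * g' s], a product of a composition of lower order
    and a completely monotone factor. The hypotheses on [g] are those of a Bernstein function
    mapping (1, +oo) into itself. *)
Lemma cm_comp (n : nat) : forall (f g g' : R -> R), cm n f ->
  (forall s, 1 < s -> 1 < g s) -> (forall s, 1 < s -> is_derive g s (g' s)) ->
  (forall m, cm m g') -> cm n (fun s => f (g s)).
Proof.
  induction n as [|n IH]; intros f g g' Cf Hg Dg Cg.
  - intros s Hs. apply Cf. now apply Hg.
  - destruct Cf as [Hf [f' [Df Cf]]]. split.
    + intros s Hs. apply Hf. now apply Hg.
    + exists (fun s => f' (g s) * g' s). split.
      * intros s Hs.
        replace (- (f' (g s) * g' s)) with (g' s * - f' (g s)) by ring.
        apply (is_derive_comp f g s (- f' (g s)) (g' s)); [apply Df|]; auto.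
      * apply cm_mult; [|apply Cg]. now apply (IH f' g g').
Qed.

(** This is [(-1)^k] times the [k]-th derivative of [s^(-t)]. *)
Definition pw (t : R) (k : nat) (s : R) : R := rising t k * Rpower s (- t - INR k).

Lemma pw_0 (t s : R) : pw t 0 s = Rpower s (- t).
Proof. unfold pw. simpl. rewrite Rminus_0_r. ring. Qed.

Lemma pw_derive (t : R) (k : nat) (s : R) : 0 < s ->
  is_derive (pw t k) s (- pw t (S k) s).
Proof.
  intros Hs. unfold pw.
  replace (- (rising t (S k) * Rpower s (- t - INR (S k))))
    with (rising t k * ((- t - INR k) * Rpower s (- t - INR k - 1))).
  - apply (is_derive_scal (fun y => Rpower y (- t - INR k))).
    now apply is_derive_Rpower.
  - rewrite S_INR. replace (- t - (INR k + 1)) with (- t - INR k - 1) by ring.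
    simpl. ring.
Qed.

Lemma pw_nonneg (t : R) (k : nat) (s : R) : 0 <= t -> 0 <= pw t k s.
Proof.
  intros Ht. apply Rmult_le_pos; [now apply rising_nonneg|left; apply exp_pos].
Qed.

Lemma cm_pw (n : nat) (t : R) : 0 <= t -> cm n (fun s => Rpower s (- t)).
Proof.
  intros Ht. apply (cm_ext n (pw t 0)); [intros; apply pw_0|].
  apply cm_of_derivatives.
  - intros k s Hs. apply pw_derive. lra.
  - intros k s _. now apply pw_nonneg.
Qed.

(** The Pochhammer symbol of [- g] starts with the single nonpositive factor [- g]; the remaining
    factors start at [1 - g >= 0]. *)
Lemma pw_neg_exponent_nonpos (g : R) (k : nat) (s : R) : 0 <= g <= 1 ->
  pw (- g) (S k) s <= 0.
Proof.
  intros Hg. unfold pw. rewrite rising_shift.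
  pose proof (rising_nonneg (- g + 1) k ltac:(lra)).
  pose proof (exp_pos ((- - g - INR (S k)) * ln s)). unfold Rpower.
  assert (0 <= g * rising (- g + 1) k) by nra. nra.
Qed.

(** Here the first two factors, [- g] and [1 - g], are both nonpositive and their signs cancel. *)
Lemma pw_neg_exponent_nonneg (g : R) (k : nat) (s : R) : 1 <= g <= 2 ->
  0 <= pw (- g) (S (S k)) s.
Proof.
  intros Hg. unfold pw. rewrite rising_shift, rising_shift.
  pose proof (rising_nonneg (- g + 1 + 1) k ltac:(lra)).
  pose proof (exp_pos ((- - g - INR (S (S k))) * ln s)). unfold Rpower.
  assert (0 <= - g * (- g + 1)) by nra.
  apply Rmult_le_pos; [|lra]. rewrite <- Rmult_assoc. now apply Rmult_le_pos.
Qed.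

(** * Divided differences *)

(* With [F^(k) = (-1)^k f_k], this is [N!] times the difference between the
   Taylor polynomial of order [N] of [F] around [s], evaluated at [1], and [F 1]. *)
Fixpoint taylor_gap (f : nat -> R -> R) (N : nat) (s : R) : R :=
  match N with
  | O => f O s - f O 1
  | S k => INR (S k) * taylor_gap f k s + (s - 1) ^ (S k) * f (S k) s
  end.

(** With [F = f 0], this is [(-1)^N] times the [N]-th derivative of [(F s - F 1) / (s - 1)]: the
    quotient rule reproduces the recursion of [taylor_gap]. *)
Definition divided_difference (f : nat -> R -> R) (N : nat) (s : R) : R :=
  taylor_gap f N s / (s - 1) ^ (S N).

Lemma taylor_gap_at_1 (f : nat -> R -> R) (N : nat) : taylor_gap f N 1 = 0.
Proof.
  induction N as [|N IH]; simpl taylor_gap; [ring|]. rewrite IH. simpl. ring.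
Qed.

Lemma is_derive_pow_minus_1 (N : nat) (s : R) :
  is_derive (fun y => (y - 1) ^ S N) s (INR (S N) * (s - 1) ^ N).
Proof.
  auto_derive; [trivial|].
  change (1 * (INR (S N) * (s - 1) ^ N) = INR (S N) * (s - 1) ^ N). ring.
Qed.

(** When a Taylor polynomial is differentiated in its base point, the terms telescope and only the
    one of top order survives. *)
Lemma taylor_gap_derive (f : nat -> R -> R) :
  (forall k s, 0 < s -> is_derive (f k) s (- f (S k) s)) ->
  forall N s, 0 < s ->
  is_derive (taylor_gap f N) s (- ((s - 1) ^ N * f (S N) s)).
Proof.
  intros Hf. induction N as [|N IH]; intros s Hs.
  - simpl taylor_gap.
    replace (- ((s - 1) ^ 0 * f 1%nat s)) with (- f 1%nat s - 0) by (simpl; ring).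
    apply (is_derive_minus (f O) (fun _ => f O 1) s (- f 1%nat s) 0).
    + now apply Hf.
    + apply (is_derive_const (f O 1) s).
  - apply (is_derive_ext
      (fun y => INR (S N) * taylor_gap f N y + (y - 1) ^ (S N) * f (S N) y));
      [intros; reflexivity|].
    replace (- ((s - 1) ^ S N * f (S (S N)) s)) with
      (INR (S N) * - ((s - 1) ^ N * f (S N) s) +
       (INR (S N) * (s - 1) ^ N * f (S N) s + (s - 1) ^ S N * - f (S (S N)) s)) by ring.
    apply (is_derive_plus (fun y => INR (S N) * taylor_gap f N y)
             (fun y => (y - 1) ^ (S N) * f (S N) y)).
    + apply (is_derive_scal (taylor_gap f N)). now apply IH.
    + apply (is_derive_mult (fun y => (y - 1) ^ (S N)) (f (S N)) s
               (INR (S N) * (s - 1) ^ N)).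
      * apply is_derive_pow_minus_1.
      * now apply Hf.
      * intros; apply Rmult_comm.
Qed.

Lemma divided_difference_derive (f : nat -> R -> R) :
  (forall k s, 0 < s -> is_derive (f k) s (- f (S k) s)) ->
  forall N s, 1 < s ->
  is_derive (divided_difference f N) s (- divided_difference f (S N) s).
Proof.
  intros Hf N s Hs. unfold divided_difference.
  assert (Hp : (s - 1) ^ S N <> 0) by (apply pow_nonzero; lra).
  replace (- (taylor_gap f (S N) s / (s - 1) ^ S (S N))) with
    ((- ((s - 1) ^ N * f (S N) s) * (s - 1) ^ S N -
      taylor_gap f N s * (INR (S N) * (s - 1) ^ N)) / ((s - 1) ^ S N) ^ 2).
  - apply (is_derive_div (taylor_gap f N) (fun y => (y - 1) ^ S N)).
    + apply taylor_gap_derive; [exact Hf|lra].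
    + apply is_derive_pow_minus_1.
    + exact Hp.
  - change (taylor_gap f (S N) s)
      with (INR (S N) * taylor_gap f N s + (s - 1) ^ (S N) * f (S N) s).
    assert ((s - 1) ^ N <> 0) by (apply pow_nonzero; lra).
    set (p := (s - 1) ^ N) in *.
    replace ((s - 1) ^ S (S N)) with ((s - 1) * (s - 1) * p) by (unfold p; simpl; ring).
    replace ((s - 1) ^ S N) with ((s - 1) * p) by (unfold p; simpl; ring).
    field. split; [exact H|lra].
Qed.

(** The Taylor gap vanishes at 1 and its derivative is [- (s - 1)^N * f (S N) s], so the sign of
    [f (S N)] alone decides. *)
Lemma divided_difference_nonneg (f : nat -> R -> R) (N : nat) :
  (forall k s, 0 < s -> is_derive (f k) s (- f (S k) s)) ->
  (forall s, 1 <= s -> f (S N) s <= 0) ->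
  forall s, 1 < s -> 0 <= divided_difference f N s.
Proof.
  intros Hf Hs' s Hs. unfold divided_difference.
  apply Rmult_le_pos; [|left; apply Rinv_0_lt_compat, pow_lt; lra].
  rewrite <- (taylor_gap_at_1 f N).
  apply (nonneg_derive_le _ (fun y => - ((y - 1) ^ N * f (S N) y))); [lra| |].
  - intros y Hy. apply taylor_gap_derive; [exact Hf|lra].
  - intros y Hy. pose proof (pow_le (y - 1) N ltac:(lra)).
    pose proof (Hs' y ltac:(lra)). nra.
Qed.

Lemma divided_difference_nonpos (f : nat -> R -> R) (N : nat) :
  (forall k s, 0 < s -> is_derive (f k) s (- f (S k) s)) ->
  (forall s, 1 <= s -> 0 <= f (S N) s) ->
  forall s, 1 < s -> divided_difference f N s <= 0.
Proof.
  intros Hf Hs' s Hs. unfold divided_difference.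
  assert (taylor_gap f N s <= 0).
  { rewrite <- (taylor_gap_at_1 f N). apply Ropp_le_cancel.
    apply (nonneg_derive_le (fun y => - taylor_gap f N y)
             (fun y => (y - 1) ^ N * f (S N) y)); [lra| |].
    - intros y Hy. rewrite <- (Ropp_involutive (_ * _)).
      apply (is_derive_opp (taylor_gap f N)).
      apply taylor_gap_derive; [exact Hf|lra].
    - intros y Hy. pose proof (pow_le (y - 1) N ltac:(lra)).
      pose proof (Hs' y ltac:(lra)). nra. }
  assert (0 < / (s - 1) ^ S N) by (apply Rinv_0_lt_compat, pow_lt; lra).
  unfold Rdiv. nra.
Qed.

Lemma divided_difference_pw (g s : R) :
  divided_difference (pw (- g)) 0 s = (Rpower s g - 1) / (s - 1).
Proof.
  unfold divided_difference. simpl taylor_gap. rewrite !pw_0, Ropp_involutive.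
  replace (Rpower 1 g) with 1; [simpl; now rewrite Rmult_1_r|].
  unfold Rpower. now rewrite ln_1, Rmult_0_r, exp_0.
Qed.

Lemma cm_power_quotient (n : nat) (g : R) : 0 <= g <= 1 ->
  cm n (fun s => (Rpower s g - 1) / (s - 1)).
Proof.
  intros Hg. apply (cm_ext n (divided_difference (pw (- g)) 0)).
  { intros; apply divided_difference_pw. }
  apply cm_of_derivatives.
  - intros k s Hs. apply divided_difference_derive; [|exact Hs].
    intros; now apply pw_derive.
  - intros k s Hs. apply divided_difference_nonneg; [| |exact Hs].
    + intros; now apply pw_derive.
    + intros; now apply pw_neg_exponent_nonpos.
Qed.

(* For [1 < a <= 2] the reciprocal [(s^a - 1)/(s - 1)] is a Bernstein function. *)
Lemma cm_inv_power_quotient (n : nat) (a : R) : 1 < a <= 2 ->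
  cm n (fun s => (s - 1) / (Rpower s a - 1)).
Proof.
  intros Ha.
  assert (Hpw : forall k s, 0 < s -> is_derive (pw (- a) k) s (- pw (- a) (S k) s))
    by (intros; now apply pw_derive).
  apply (cm_ext n (fun s => Rpower (divided_difference (pw (- a)) 0 s) (- (1)))).
  { intros s Hs. rewrite divided_difference_pw.
    pose proof (Rpower_gt_1 s a Hs ltac:(lra)).
    rewrite Rpower_Ropp, Rpower_1.
    - field. lra.
    - apply Rdiv_lt_0_compat; lra. }
  apply (cm_comp n (fun u => Rpower u (- (1))) (divided_difference (pw (- a)) 0)
           (fun s => - divided_difference (pw (- a)) 1 s)).
  - apply cm_pw. lra.
  (* Strictness of [1 < a] gives [s^a > s], so the quotient exceeds 1 as [cm_comp] demands. *)
  - intros s Hs. rewrite divided_difference_pw.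
    pose proof (Rpower_lt s 1 a Hs ltac:(lra)). rewrite Rpower_1 in H by lra.
    apply (Rlt_div_r 1); lra.
  - intros s Hs. now apply divided_difference_derive.
  - intros m. apply (cm_of_derivatives (fun k s => - divided_difference (pw (- a)) (S k) s))
      with (k := O).
    + intros k s Hs. apply (is_derive_opp (divided_difference (pw (- a)) (S k))).
      now apply divided_difference_derive.
    + intros k s Hs. apply Ropp_0_ge_le_contravar, Rle_ge.
      apply divided_difference_nonpos; [exact Hpw| |exact Hs].
      intros; apply pw_neg_exponent_nonneg; lra.
Qed.

(** * The generating function of the exponents *)

(** The coefficients [n c_n] are those of [z] times the derived series. *)
Lemma CV_radius_INR_mult (c : nat -> R) :
  CV_radius (fun n => INR n * c n) = CV_radius c.
Proof.
  rewrite <- (CV_radius_derive c), <- (CV_radius_incr_1 (PS_derive c)).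
  apply CV_radius_ext. intros [|n]; simpl INR.
  - rewrite Rmult_0_l. reflexivity.
  - reflexivity.
Qed.

(** Under [z = s^a], the operator [s d/ds] becomes [a z d/dz], which multiplies the [n]-th
    coefficient by [a n]. *)
Lemma PSeries_Rpower_derive (c : nat -> R) (a s : R) : 0 < s ->
  Rbar_lt (Rabs (Rpower s a)) (CV_radius c) ->
  is_derive (fun y => PSeries c (Rpower y a)) s
    (a / s * PSeries (fun n => INR n * c n) (Rpower s a)).
Proof.
  intros Hs Hc.
  replace (a / s * PSeries (fun n => INR n * c n) (Rpower s a)) with
    (a * Rpower s (a - 1) * PSeries (PS_derive c) (Rpower s a)).
  - apply (is_derive_comp (PSeries c) (fun y => Rpower y a)).
    + now apply is_derive_PSeries.
    + now apply is_derive_Rpower.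
  - rewrite (PSeries_ext (fun n => INR n * c n) (PS_incr_1 (PS_derive c))).
    + rewrite PSeries_incr_1. unfold Rminus.
      rewrite Rpower_plus, Rpower_Ropp, Rpower_1 by exact Hs. field. lra.
    + intros [|n]; simpl INR; [rewrite Rmult_0_l|]; reflexivity.
Qed.

(** Raising the order multiplies the [n]-th coefficient by [n a + N], which gives a linear
    combination of [c n] and [n * c n]; neither operation shrinks the radius below 1. *)
Lemma rising_coef_CV_radius (a : R) (N : nat) :
  Rbar_le 1 (CV_radius (fun n => rising (INR n * a) N)).
Proof.
  induction N as [|N IH].
  - rewrite (CV_radius_finite_DAlembert _ 1).
    + rewrite Rinv_1. apply Rbar_le_refl.
    + intros n. simpl. lra.
    + lra.
    + apply (is_lim_seq_ext (fun _ => 1)); [|apply is_lim_seq_const].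
      intros n. simpl. unfold Rdiv. now rewrite Rinv_1, Rmult_1_l, Rabs_R1.
  - set (c := fun n => rising (INR n * a) N) in *.
    rewrite (CV_radius_ext _ (PS_plus (PS_scal (INR N) c)
                                (PS_scal a (fun n => INR n * c n)))).
    + eapply Rbar_le_trans; [|apply CV_radius_plus].
      (* The scalar 0 does occur, at [N = 0]; the scaled series is then null and bounded at 1. *)
      assert (Hscal : forall k d, Rbar_le 1 (CV_radius d) ->
                                  Rbar_le 1 (CV_radius (PS_scal k d))).
      { intros k d Hd. destruct (Req_dec k 0) as [->|Hk]; [|now rewrite CV_radius_scal].
        apply (proj1 (CV_radius_bounded (PS_scal 0 d))). exists 0. intros n.
        unfold PS_scal, scal; simpl; unfold mult; simpl.
        rewrite Rmult_0_l, Rmult_0_l, Rabs_R0. apply Rle_refl. }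
      apply Rbar_min_case; apply Hscal; [exact IH|].
      now rewrite CV_radius_INR_mult.
    + intros n. unfold PS_plus, PS_scal, plus, scal; simpl. unfold mult; simpl.
      unfold c. ring.
Qed.

Lemma Rpower_neg_lt_1 (s a : R) : 1 < s -> 0 < a -> Rpower s (- a) < 1.
Proof.
  intros Hs Ha. rewrite <- (Rpower_O s) by lra. apply Rpower_lt; lra.
Qed.

Lemma rising_coef_inside (a s : R) (N : nat) : 0 < a -> 1 < s ->
  Rbar_lt (Rabs (Rpower s (- a))) (CV_radius (fun n => rising (INR n * a) N)).
Proof.
  intros Ha Hs. eapply Rbar_lt_le_trans; [|apply rising_coef_CV_radius].
  simpl. rewrite Rabs_pos_eq by (left; apply exp_pos).
  now apply Rpower_neg_lt_1.
Qed.

(** This is [(-1)^N] times the [N]-th derivative of the sum of [s^(-na)], taken termwise, with the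
    common factor [s^(-N)] pulled out. *)
Definition geom_deriv (a : R) (N : nat) (s : R) : R :=
  Rpower s (- INR N) * PSeries (fun n => rising (INR n * a) N) (Rpower s (- a)).

Lemma geom_deriv_0 (a s : R) : 0 < a -> 1 < s ->
  geom_deriv a 0 s = / (1 - Rpower s (- a)).
Proof.
  intros Ha Hs. unfold geom_deriv, PSeries. simpl INR.
  rewrite Ropp_0, Rpower_O by lra. rewrite Rmult_1_l.
  apply is_series_unique.
  apply (is_series_ext (fun n => Rpower s (- a) ^ n)).
  - intros n. simpl. ring.
  - apply is_series_geom. rewrite Rabs_pos_eq by (left; apply exp_pos).
    now apply Rpower_neg_lt_1.
Qed.

Lemma geom_deriv_derive (a : R) (N : nat) (s : R) : 0 < a -> 1 < s ->
  is_derive (geom_deriv a N) s (- geom_deriv a (S N) s).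
Proof.
  intros Ha Hs. unfold geom_deriv.
  set (c := fun n => rising (INR n * a) N).
  pose proof (rising_coef_inside a s N Ha Hs) as Hc. fold c in Hc.
  assert (E : PSeries (fun n => rising (INR n * a) (S N)) (Rpower s (- a)) =
    INR N * PSeries c (Rpower s (- a)) +
    a * PSeries (fun n => INR n * c n) (Rpower s (- a))).
  { rewrite <- !PSeries_scal, <- PSeries_plus.
    - apply PSeries_ext. intros n.
      unfold PS_plus, PS_scal, plus, scal; simpl. unfold mult; simpl.
      unfold c. ring.
    - apply ex_pseries_scal; [apply Rmult_comm|]. now apply CV_radius_inside.
    - apply ex_pseries_scal; [apply Rmult_comm|]. apply CV_radius_inside.
      now rewrite CV_radius_INR_mult. }
  rewrite E.
  replace (- (Rpower s (- INR (S N)) * _)) with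
    (- INR N * Rpower s (- INR N - 1) * PSeries c (Rpower s (- a)) +
     Rpower s (- INR N) * (- a / s * PSeries (fun n => INR n * c n) (Rpower s (- a)))).
  - apply (is_derive_mult (fun y => Rpower y (- INR N))
             (fun y => PSeries c (Rpower y (- a)))).
    + apply is_derive_Rpower. lra.
    + apply PSeries_Rpower_derive; [lra|exact Hc].
    + intros; apply Rmult_comm.
  - replace (- INR (S N)) with (- INR N - 1) by (rewrite S_INR; ring).
    unfold Rminus. rewrite Rpower_plus, (Rpower_Ropp s 1), Rpower_1 by lra.
    field. lra.
Qed.

Lemma Series_nonneg (u : nat -> R) :
  ex_series u -> (forall n, 0 <= u n) -> 0 <= Series u.
Proof.
  intros Hu Hp. rewrite <- (Rmult_0_l (Series u)), <- Series_scal_l.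
  apply Series_le; [|exact Hu]. intros n. specialize (Hp n). lra.
Qed.

Lemma PSeries_nonneg (c : nat -> R) (z : R) :
  Rbar_lt (Rabs z) (CV_radius c) -> (forall n, 0 <= c n) -> 0 <= z ->
  0 <= PSeries c z.
Proof.
  intros Hc Hp Hz. apply Series_nonneg.
  - apply ex_pseries_R. now apply CV_radius_inside.
  - intros n. apply Rmult_le_pos; [apply Hp|now apply pow_le].
Qed.

Lemma cm_geometric (n : nat) (a : R) : 0 < a ->
  cm n (fun s => / (1 - Rpower s (- a))).
Proof.
  intros Ha. apply (cm_ext n (geom_deriv a 0)).
  { intros; now apply geom_deriv_0. }
  apply cm_of_derivatives.
  - intros; now apply geom_deriv_derive.
  - intros k s Hs. apply Rmult_le_pos; [left; apply exp_pos|].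
    apply PSeries_nonneg.
    + now apply rising_coef_inside.
    + intros m. apply rising_nonneg. apply Rmult_le_pos; [apply pos_INR|lra].
    + left; apply exp_pos.
Qed.

Lemma cm_geometric_gap (n : nat) (a b : R) : 0 < a -> a < b ->
  (b <= 1 \/ (1 <= a /\ b <= 2)) ->
  cm n (fun s => / (1 - Rpower s (- a)) - / (1 - Rpower s (- b))).
Proof.
  intros Ha Hab Hcase.
  assert (Hpos : forall s, 1 < s -> 1 < Rpower s a /\ 1 < Rpower s b)
    by (intros; split; apply Rpower_gt_1; lra).
  destruct Hcase as [Hb|[Ha1 Hb]].
  - apply (cm_ext n (fun s => (Rpower (Rpower s b) ((b - a) / b) - 1) / (Rpower s b - 1)
                              * / (1 - Rpower s (- a)))).
    { intros s Hs. specialize (Hpos s Hs).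
      rewrite Rpower_mult. replace (b * ((b - a) / b)) with (b + - a) by (field; lra).
      rewrite Rpower_plus, !Rpower_Ropp. field. lra. }
    apply cm_mult; [|now apply cm_geometric].
    (* The inner function [s^b] has derivative [b s^(-(1-b))], completely monotone since
       [b <= 1]. *)
    apply (cm_comp n (fun u => (Rpower u ((b - a) / b) - 1) / (u - 1))
             (fun s => Rpower s b) (fun s => b * Rpower s (- (1 - b)))).
    + apply cm_power_quotient. split.
      * apply Rdiv_le_0_compat; lra.
      * apply Rle_div_l; lra.
    + intros s Hs. apply Hpos, Hs.
    + intros s Hs. rewrite Ropp_minus_distr. apply is_derive_Rpower. lra.
    + intros m. apply (cm_mult m (fun _ => b)); [|apply cm_pw; lra].
      apply cm_const; lra.
  - apply (cm_ext n (fun s => (Rpower s (b - a) - 1) / (s - 1) *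
             ((s - 1) / (Rpower s a - 1) * (Rpower s (- (b - a)) * / (1 - Rpower s (- b)))))).
    { intros s Hs. specialize (Hpos s Hs).
      rewrite Ropp_minus_distr. unfold Rminus.
      rewrite !Rpower_plus, !Rpower_Ropp. field. lra. }
    apply cm_mult; [apply cm_power_quotient; lra|].
    apply cm_mult; [|apply cm_mult; [apply cm_pw|apply cm_geometric]; lra].
    (* For [a = 1] the middle factor is the constant 1, written as [s^(-0)]. *)
    destruct (Req_dec a 1) as [->|Hne]; [|apply cm_inv_power_quotient; lra].
    apply (cm_ext n (fun s => Rpower s (- 0))); [|apply cm_pw; lra].
    intros s Hs. rewrite Ropp_0, Rpower_O, Rpower_1 by lra. field. lra.
Qed.

(** * The Gamma function on [1, +oo) *)

Definition gamma_integrand (s t : R) : R := Rpower t (s - 1) * exp (- t).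

Lemma filter_prod_0_infty (P : R -> R -> Prop) (a0 b0 : R) : 0 < a0 ->
  (forall a b, 0 < a < a0 -> b0 < b -> P a b) ->
  filter_prod (at_right 0) (Rbar_locally p_infty) (fun ab => P (fst ab) (snd ab)).
Proof.
  intros Ha0 HP.
  exists (fun a => 0 < a < a0) (fun b => b0 < b).
  - exists (mkposreal a0 Ha0). intros y Hy Hy0. split; [exact Hy0|].
    unfold ball in Hy; simpl in Hy; unfold AbsRing_ball, abs, minus, plus, opp in Hy; simpl in Hy.
    rewrite Ropp_0, Rplus_0_r in Hy. apply Rabs_def2 in Hy. lra.
  - now exists b0.
  - intros a b Ha Hb. now apply HP.
Qed.

(** For a nonnegative integrand the integral grows with the interval, so the supremum over all
    intervals is the improper integral. *)
Lemma is_RInt_gen_of_bounded (f : R -> R) (B : R) :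
  (forall t, 0 < t -> continuous f t) -> (forall t, 0 < t -> 0 <= f t) ->
  (forall a b, 0 < a -> a < b -> RInt f a b <= B) ->
  exists l, is_RInt_gen f (at_right 0) (Rbar_locally p_infty) l /\
            (forall a b, 0 < a -> a < b -> RInt f a b <= l).
Proof.
  intros Hc Hp HB.
  assert (Hex : forall a b, 0 < a -> 0 < b -> ex_RInt f a b).
  { intros a b Ha Hb. apply (ex_RInt_continuous (V := R_CompleteNormedModule)).
    intros z Hz. apply Hc. eapply Rlt_le_trans; [|apply Hz].
    now apply Rmin_glb_lt. }
  destruct (completeness (fun r => exists a b, 0 < a /\ a < b /\ r = RInt f a b))
    as [l [Hub Hlub]].
  - exists B. intros r (a & b & Ha & Hb & ->). now apply HB.
  - exists (RInt f 1 2), 1, 2. repeat split; lra.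
  - assert (Hl : forall a b, 0 < a -> a < b -> RInt f a b <= l)
      by (intros a b Ha Hb; apply Hub; now exists a, b).
    exists l. split; [|exact Hl].
    intros P [eps HP].
    (* Some interval comes within [eps] of the supremum; larger ones do too, since the added pieces
       contribute nonnegatively. *)
    assert (exists a0 b0, 0 < a0 /\ a0 < b0 /\ l - eps < RInt f a0 b0) as
      (a0 & b0 & Ha0 & Hb0 & Hlow).
    { destruct (Classical_Prop.classic
        (exists a0 b0, 0 < a0 /\ a0 < b0 /\ l - eps < RInt f a0 b0)) as [H|H]; [exact H|].
      exfalso. pose proof (cond_pos eps).
      assert (l <= l - eps); [|lra].
      apply Hlub. intros r (a & b & Ha & Hb & ->). apply Rnot_lt_le. intros Hlt.
      apply H. now exists a, b. }
    apply (filter_prod_0_infty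
      (fun a b => exists y, is_RInt f a b y /\ P y) a0 b0 Ha0).
    intros a b Ha Hb. exists (RInt f a b). split.
    + apply (RInt_correct (V := R_CompleteNormedModule)). apply Hex; lra.
    + apply HP. assert (l - eps < RInt f a b <= l).
      { split; [|apply Hl; lra].
        rewrite <- (RInt_Chasles f a a0 b) by (apply Hex; lra).
        rewrite <- (RInt_Chasles f a0 b0 b) by (apply Hex; lra).
        unfold plus; simpl.
        assert (0 <= RInt f a a0).
        { apply RInt_ge_0; [lra|apply Hex; lra|]. intros t Ht; apply Hp; lra. }
        assert (0 <= RInt f b0 b).
        { apply RInt_ge_0; [lra|apply Hex; lra|]. intros t Ht; apply Hp; lra. }
        lra. }
      unfold ball; simpl; unfold AbsRing_ball, abs, minus, plus, opp; simpl.
      apply Rabs_def1; lra.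
Qed.

Lemma gamma_integrand_pos (s t : R) : 0 < gamma_integrand s t.
Proof. apply Rmult_lt_0_compat; apply exp_pos. Qed.

Lemma gamma_integrand_continuous (s t : R) : 0 < t -> continuous (gamma_integrand s) t.
Proof.
  intros Ht. apply (ex_derive_continuous (gamma_integrand s)).
  unfold gamma_integrand, Rpower. auto_derive. exact Ht.
Qed.

Lemma ln_le_minus_1 (u : R) : 0 < u -> ln u <= u - 1.
Proof.
  intros Hu. pose proof (exp_ineq1_le (ln u)) as H. rewrite exp_ln in H by exact Hu. lra.
Qed.

(** Apply [ln u <= u - 1] at [u = t / (2 * s)]: the scale [2 * s] makes the power cost at most
    [exp (t / 2)], leaving half of the exponential decay. *)
Lemma gamma_integrand_bound (s t : R) : 1 <= s -> 0 < t ->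
  gamma_integrand s t <= exp ((s - 1) * ln (2 * s)) * exp (- t / 2).
Proof.
  intros Hs Ht. unfold gamma_integrand, Rpower. rewrite <- !exp_plus.
  assert (Hln : ln (t / (2 * s)) <= t / (2 * s) - 1)
    by (apply ln_le_minus_1, Rdiv_lt_0_compat; lra).
  rewrite ln_div in Hln by lra.
  assert ((s - 1) * (ln t - ln (2 * s)) <= t / 2).
  { apply Rle_trans with ((s - 1) * (t / (2 * s) - 1)).
    - apply Rmult_le_compat_l; lra.
    - replace (t / 2) with (s * (t / (2 * s))) by (field; lra).
      assert (0 < t / (2 * s)) by (apply Rdiv_lt_0_compat; lra). nra. }
  destruct (Rle_lt_or_eq_dec ((s - 1) * ln t + - t)
              ((s - 1) * ln (2 * s) + - t / 2)) as [H1|H1]; [lra| |].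
  - left. now apply exp_increasing.
  - right. now rewrite H1.
Qed.

Lemma is_Gamma (s : R) : 1 <= s ->
  is_RInt_gen (gamma_integrand s) (at_right 0) (Rbar_locally p_infty) (Gamma s) /\
  0 < Gamma s.
Proof.
  intros Hs. set (C := exp ((s - 1) * ln (2 * s))).
  assert (HC : 0 < C) by apply exp_pos.
  (* The bound [2 * C] is the integral of [C * exp (- t / 2)] over the half-line. *)
  destruct (is_RInt_gen_of_bounded (gamma_integrand s) (2 * C)) as [l [Hl Hle]].
  - intros; now apply gamma_integrand_continuous.
  - intros; left; apply gamma_integrand_pos.
  - intros a b Ha Hab.
    assert (Hint : is_RInt (fun t => C * exp (- t / 2)) a b
              (-2 * C * exp (- b / 2) - -2 * C * exp (- a / 2))).
    { apply (is_RInt_derive (fun t => -2 * C * exp (- t / 2))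
               (fun t => C * exp (- t / 2))).
      - intros t _. auto_derive; [trivial|]. unfold Rdiv. field.
      - intros t _. apply (ex_derive_continuous (fun t => C * exp (- t / 2))).
        auto_derive. trivial. }
    apply Rle_trans with (RInt (fun t => C * exp (- t / 2)) a b).
    + apply RInt_le; [lra| |now exists (-2 * C * exp (- b / 2) - -2 * C * exp (- a / 2))|].
      * apply (ex_RInt_continuous (V := R_CompleteNormedModule)).
        intros z Hz. rewrite Rmin_left in Hz by lra.
        apply gamma_integrand_continuous. lra.
      * intros t Ht. apply gamma_integrand_bound; lra.
    + rewrite (is_RInt_unique _ _ _ _ Hint).
      pose proof (exp_pos (- b / 2)).
      assert (exp (- a / 2) < 1) by (rewrite <- exp_0; apply exp_increasing; lra).
      nra.
  - assert (E : Gamma s = l).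
    { unfold Gamma. apply (is_RInt_gen_unique (V := R_CompleteNormedModule)). exact Hl. }
    rewrite E. split; [exact Hl|].
    apply Rlt_le_trans with (RInt (gamma_integrand s) 1 2); [|apply Hle; lra].
    apply RInt_gt_0; [lra| |].
    + intros; apply gamma_integrand_pos.
    + intros; apply gamma_integrand_continuous; lra.
Qed.

Lemma Gamma_pos (s : R) : 1 <= s -> 0 < Gamma s.
Proof. intros Hs. now apply is_Gamma. Qed.

Lemma is_RInt_gen_gamma_primitive (f F : R -> R) (la lb l : R) :
  (forall t, 0 < t -> is_derive F t (f t)) -> (forall t, 0 < t -> continuous f t) ->
  filterlim F (at_right 0) (locally la) ->
  filterlim F (Rbar_locally p_infty) (locally lb) ->
  l = lb - la -> is_RInt_gen f (at_right 0) (Rbar_locally p_infty) l.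
Proof.
  intros HF Hf Ha Hb ->.
  assert (Hpos : forall P : R -> Prop, (forall t, 0 < t -> P t) ->
    filter_prod (at_right 0) (Rbar_locally p_infty)
      (fun ab => forall x, Rmin (fst ab) (snd ab) <= x <= Rmax (fst ab) (snd ab) -> P x)).
  { intros P HP.
    apply (filter_prod_0_infty (fun a b => forall x, Rmin a b <= x <= Rmax a b -> P x)
             1 1 Rlt_0_1).
    intros a b Ha' Hb' x Hx. apply HP. rewrite Rmin_left in Hx; lra. }
  apply (is_RInt_gen_ext (Derive F)).
  - generalize (Hpos (fun x => Derive F x = f x)
                  (fun t Ht => is_derive_unique _ _ _ (HF t Ht))).
    apply filter_imp. intros ab H x Hx. apply H. lra.
  - apply is_RInt_gen_Derive; [| |exact Ha|exact Hb].
    + apply Hpos. intros t Ht. exists (f t). now apply HF.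
    + apply Hpos. intros t Ht. apply (continuous_ext_loc _ f); [|now apply Hf].
      generalize (open_gt 0 t Ht). apply filter_imp. intros y Hy.
      symmetry. now apply is_derive_unique, HF.
Qed.

Lemma filterlim_exp_opp_p : filterlim (fun t => exp (- t)) (Rbar_locally p_infty) (locally 0).
Proof.
  intros P [eps HP]. exists (- ln eps). intros t Ht. apply HP.
  unfold ball; simpl; unfold AbsRing_ball, abs, minus, plus, opp; simpl.
  rewrite Ropp_0, Rplus_0_r, Rabs_pos_eq by (left; apply exp_pos).
  rewrite <- (exp_ln eps) by apply cond_pos. apply exp_increasing. lra.
Qed.

Lemma Gamma_1 : Gamma 1 = 1.
Proof.
  unfold Gamma. apply (is_RInt_gen_unique (V := R_CompleteNormedModule)).
  apply (is_RInt_gen_gamma_primitive _ (fun t => - exp (- t)) (-1) 0).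
  - intros t Ht. replace (1 - 1) with 0 by ring. rewrite Rpower_O by exact Ht.
    auto_derive; [trivial|]. ring.
  - intros t Ht. now apply (gamma_integrand_continuous 1).
  - apply (filterlim_filter_le_1 (F := locally 0)).
    { intros P HP. now apply filter_le_within. }
    replace (-1) with (- exp (- 0)) by (rewrite Ropp_0, exp_0; ring).
    apply (ex_derive_continuous (fun t => - exp (- t)) 0). auto_derive. trivial.
  - apply (filterlim_comp _ _ _ (fun t => exp (- t)) opp _ (locally 0)).
    + apply filterlim_exp_opp_p.
    + pose proof (filterlim_opp (V := R_NormedModule) 0) as H.
      change (opp 0) with (- 0) in H. rewrite Ropp_0 in H. exact H.
  - ring.
Qed.

(** Integration by parts: [s t^(s-1) e^(-t) - t^s e^(-t)] is the derivative of [t^s e^(-t)], which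
    vanishes at both ends. *)
Lemma Gamma_succ (s : R) : 1 <= s -> Gamma (s + 1) = s * Gamma s.
Proof.
  intros Hs. destruct (is_Gamma s Hs) as [H1 _].
  destruct (is_Gamma (s + 1) ltac:(lra)) as [H2 _].
  pose proof (is_RInt_gen_minus _ _ _ _ (is_RInt_gen_scal _ s _ H1) H2) as H.
  apply (is_RInt_gen_unique (V := R_CompleteNormedModule)) in H.
  assert (H0 : is_RInt_gen (fun y => minus (scal s (gamma_integrand s y))
              (gamma_integrand (s + 1) y)) (at_right 0) (Rbar_locally p_infty) 0).
  { apply (is_RInt_gen_gamma_primitive _ (fun t => Rpower t s * exp (- t)) 0 0).
    - intros t Ht. unfold gamma_integrand, minus, plus, opp, scal; simpl. unfold mult; simpl.
      replace (s + 1 - 1) with s by ring.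
      replace (s * (Rpower t (s - 1) * exp (- t)) + - (Rpower t s * exp (- t)))
        with (s * Rpower t (s - 1) * exp (- t) + Rpower t s * - exp (- t)) by ring.
      apply (is_derive_mult (fun t => Rpower t s) (fun t => exp (- t))).
      + now apply is_derive_Rpower.
      + auto_derive; [trivial|]. ring.
      + intros; apply Rmult_comm.
    - intros t Ht. apply (continuous_minus (V := R_NormedModule)).
      + apply (continuous_scal_r (V := R_NormedModule) s (gamma_integrand s)).
        now apply gamma_integrand_continuous.
      + now apply gamma_integrand_continuous.
    (* Near 0, [t^s e^(-t)] is below [t] because [s >= 1]. *)
    - intros P [eps HP].
      assert (He : 0 < Rmin 1 eps) by (apply Rmin_glb_lt; [lra|apply cond_pos]).
      exists (mkposreal _ He). intros t Ht Ht0. apply HP.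
      unfold ball in *; simpl in *; unfold AbsRing_ball, abs, minus, plus, opp in *; simpl in *.
      rewrite Ropp_0, Rplus_0_r in *. rewrite Rabs_pos_eq in Ht by lra.
      pose proof (Rmin_l 1 eps). pose proof (Rmin_r 1 eps).
      rewrite Rabs_pos_eq by (left; apply Rmult_lt_0_compat; apply exp_pos).
      assert (Rpower t s <= t).
      { rewrite <- (Rpower_1 t) at 2 by exact Ht0. unfold Rpower.
        assert (ln t < 0) by (rewrite <- ln_1; apply ln_increasing; lra).
        destruct (Req_dec s 1) as [->|Hne]; [right; reflexivity|].
        left. apply exp_increasing. nra. }
      assert (exp (- t) < 1) by (rewrite <- exp_0; apply exp_increasing; lra).
      pose proof (exp_pos (- t)). nra.
    (* At infinity, [gamma_integrand_bound] at [s + 1] leaves a constant times [exp (- t / 2)]. *)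
    - assert (Hl : filterlim (fun t => exp (s * ln (2 * (s + 1))) * exp (- (t / 2)))
                     (Rbar_locally p_infty) (locally 0)).
      { replace 0 with (exp (s * ln (2 * (s + 1))) * 0) by ring.
        apply (filterlim_comp _ _ _ (fun t => exp (- (t / 2))) (Rmult _) _ (locally 0)).
        - apply (filterlim_comp _ _ _ (fun t => t / 2) (fun t => exp (- t)) _
                   (Rbar_locally p_infty)); [|apply filterlim_exp_opp_p].
          intros P [M HM]. exists (2 * M). intros t Ht. apply HM. lra.
        - apply (filterlim_scal_r (V := R_NormedModule) _ 0). }
      intros P [eps HP]. specialize (Hl _ (locally_ball 0 eps)).
      destruct Hl as [M HM]. exists (Rmax 0 M). intros t Ht. apply HP.
      pose proof (Rmax_l 0 M). pose proof (Rmax_r 0 M).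
      specialize (HM t ltac:(lra)).
      unfold ball in *; simpl in *; unfold AbsRing_ball, abs, minus, plus, opp in *; simpl in *.
      rewrite Ropp_0, Rplus_0_r in *.
      rewrite Rabs_pos_eq in HM by (left; apply Rmult_lt_0_compat; apply exp_pos).
      rewrite Rabs_pos_eq by (left; apply Rmult_lt_0_compat; apply exp_pos).
      pose proof (gamma_integrand_bound (s + 1) t ltac:(lra) ltac:(lra)) as Hb.
      unfold gamma_integrand in Hb. replace (s + 1 - 1) with s in Hb by ring.
      replace (- t / 2) with (- (t / 2)) in Hb by (unfold Rdiv; ring). lra.
    - ring. }
  apply (is_RInt_gen_unique (V := R_CompleteNormedModule)) in H0.
  pose proof (eq_trans (eq_sym H) H0) as E.
  unfold minus, plus, opp, scal in E; simpl in E. unfold mult in E; simpl in E.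
  lra.
Qed.

(** Weighted AM-GM for [u] and 1. With [v] the weighted mean, the bounds [ln w <= w - 1] at [u / v]
    and [1 / v], taken with weights [h] and [1 - h], add up to 0 on the right. *)
Lemma Rpower_le_affine (u h : R) : 0 < u -> 0 <= h <= 1 ->
  Rpower u h <= 1 - h + h * u.
Proof.
  intros Hu Hh. set (v := 1 - h + h * u).
  assert (Hv : 0 < v) by (unfold v; nra).
  pose proof (ln_le_minus_1 (u / v) (Rdiv_lt_0_compat _ _ Hu Hv)) as H1.
  pose proof (ln_le_minus_1 (1 / v) (Rdiv_lt_0_compat _ _ Rlt_0_1 Hv)) as H2.
  rewrite ln_div in H1, H2 by lra. rewrite ln_1 in H2.
  assert (E : h * (u / v - 1) + (1 - h) * (1 / v - 1) = 0) by (unfold v; field; fold v; lra).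
  assert (H : h * ln u <= ln v) by nra.
  rewrite <- (exp_ln v Hv). unfold Rpower.
  destruct H as [H|H]; [left; now apply exp_increasing|right; now rewrite H].
Qed.

(* Weighted AM-GM in the form [(t/y)^h <= (1-h) + h t/y], integrated. *)
Lemma Gamma_add_le (y h : R) : 1 <= y -> 0 <= h <= 1 ->
  Gamma (y + h) <= Rpower y h * Gamma y.
Proof.
  intros Hy Hh. destruct (is_Gamma y Hy) as [H1 _].
  destruct (is_Gamma (y + 1) ltac:(lra)) as [H2 _].
  destruct (is_Gamma (y + h) ltac:(lra)) as [H3 Hp].
  set (c := Rpower y h). assert (Hc : 0 < c) by apply exp_pos.
  pose proof (is_RInt_gen_plus _ _ _ _ (is_RInt_gen_scal _ (c * (1 - h)) _ H1)
                (is_RInt_gen_scal _ (c * (h / y)) _ H2)) as H.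
  pose proof (fun A B => RInt_gen_norm _ _ _ _ A B H3 H) as Hle.
  unfold plus, scal, mult, norm in Hle; simpl in Hle.
  unfold plus, scal, mult, norm, abs in Hle; simpl in Hle.
  rewrite (Rabs_pos_eq (Gamma (y + h))), Gamma_succ in Hle by lra.
  (* With [Gamma (y + 1) = y * Gamma y], the weights [1 - h] and [h] recombine to 1. *)
  replace (c * Gamma y) with (c * (1 - h) * Gamma y + c * (h / y) * (y * Gamma y))
    by (field; lra).
  apply Hle.
  - apply (filter_prod_0_infty (fun a b => a <= b) 1 1); intros; lra.
  - apply (filter_prod_0_infty (fun a b => forall t, a <= t <= b ->
      Rabs (gamma_integrand (y + h) t) <= c * (1 - h) * gamma_integrand y t +
        c * (h / y) * gamma_integrand (y + 1) t) 1 1); [lra|].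
    intros a b Ha Hb t Ht.
    rewrite Rabs_pos_eq by (left; apply gamma_integrand_pos).
    unfold gamma_integrand.
    replace (y + 1 - 1) with (y - 1 + 1) by ring.
    replace (y + h - 1) with (y - 1 + h) by ring.
    rewrite !Rpower_plus, Rpower_1 by lra.
    assert (Hk : Rpower t h <= c * (1 - h + h * (t / y))).
    { replace t with (y * (t / y)) at 1 by (field; lra).
      assert (0 < t / y) by (apply Rdiv_lt_0_compat; lra).
      rewrite <- Rpower_mult_distr by lra. fold c.
      apply Rmult_le_compat_l; [lra|].
      now apply Rpower_le_affine. }
    pose proof (exp_pos (- t)). pose proof (exp_pos ((y - 1) * ln t)).
    fold (Rpower t (y - 1)) in *.
    replace (c * (1 - h) * (Rpower t (y - 1) * exp (- t)) +
       c * (h / y) * (Rpower t (y - 1) * t * exp (- t))) with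
      ((Rpower t (y - 1) * exp (- t)) * (c * (1 - h + h * (t / y)))) by (field; lra).
    replace (Rpower t (y - 1) * Rpower t h * exp (- t)) with
      ((Rpower t (y - 1) * exp (- t)) * Rpower t h) by ring.
    apply Rmult_le_compat_l; [|exact Hk]. left. now apply Rmult_lt_0_compat.
Qed.

(** * Euler's limit for the reciprocal Gamma function *)

Lemma Gamma_rising (t : R) (N : nat) : 0 <= t ->
  Gamma (1 + t + INR N) = rising (1 + t) N * Gamma (1 + t).
Proof.
  intros Ht. induction N as [|N IH].
  - simpl. rewrite Rplus_0_r. ring.
  - rewrite S_INR. replace (1 + t + (INR N + 1)) with (1 + t + INR N + 1) by ring.
    pose proof (pos_INR N). rewrite Gamma_succ, IH by lra. simpl. ring.
Qed.

Lemma Gamma_INR_fact (N : nat) : Gamma (1 + INR N) = INR (fact N).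
Proof.
  induction N as [|N IH].
  - simpl. rewrite Rplus_0_r. apply Gamma_1.
  - pose proof (pos_INR N).
    rewrite S_INR. replace (1 + (INR N + 1)) with (1 + INR N + 1) by ring.
    rewrite Gamma_succ, IH by lra. rewrite fact_simpl, mult_INR, S_INR. ring.
Qed.

Definition gamma_ratio (t : R) (N : nat) : R :=
  Gamma (1 + t + INR N) / (INR (fact N) * Rpower (INR N) t).

Lemma is_lim_seq_inv_INR_S : is_lim_seq (fun N => / INR (S N)) 0.
Proof.
  replace (Finite 0) with (Rbar_inv p_infty) by reflexivity.
  apply is_lim_seq_inv; [|discriminate].
  apply -> (is_lim_seq_incr_1 INR). apply is_lim_seq_INR.
Qed.

(** A squeeze between [x / (1 + x)] and [1 + 1 / x], where [x = INR (S N)]. For the upper bound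
    [Gamma_add_le] climbs by [t] from [1 + x]; for the lower bound it climbs by [1 - t] from
    [1 + t + x] to [2 + x], where Gamma is a factorial. *)
Lemma gamma_ratio_lim_01 (t : R) : 0 <= t <= 1 ->
  is_lim_seq (fun N => gamma_ratio t (S N)) 1.
Proof.
  intros Ht.
  assert (Hlim : is_lim_seq (fun N => 1 + / INR (S N)) 1).
  { replace (Finite 1) with (Finite (1 + 0)) by (f_equal; ring).
    apply is_lim_seq_plus'; [apply is_lim_seq_const|apply is_lim_seq_inv_INR_S]. }
  apply (is_lim_seq_le_le (fun N => / (1 + / INR (S N))) _ (fun N => 1 + / INR (S N)));
    [|replace (Finite 1) with (Rbar_inv 1) by (simpl; f_equal; lra);
      apply is_lim_seq_inv; [exact Hlim|intros H; injection H; lra]|exact Hlim].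
  intros N. unfold gamma_ratio. set (x := INR (S N)).
  assert (Hx : 1 <= x) by (unfold x; rewrite S_INR; pose proof (pos_INR N); lra).
  set (F := INR (fact (S N))).
  assert (HF : 0 < F) by (apply lt_0_INR, lt_O_fact).
  assert (EF : Gamma (1 + x) = F) by apply Gamma_INR_fact.
  assert (Hxt : 0 < Rpower x t) by apply exp_pos.
  assert (Hinv : 1 / x = / x) by (unfold Rdiv; ring).
  split.
  - pose proof (Gamma_add_le (1 + t + x) (1 - t) ltac:(lra) ltac:(lra)) as Hl.
    replace (1 + t + x + (1 - t)) with (1 + x + 1) in Hl by ring.
    rewrite Gamma_succ, EF in Hl by lra.
    set (G := Gamma (1 + t + x)) in *.
    unfold Rminus in Hl. rewrite Rpower_plus, Rpower_1, Rpower_Ropp in Hl by lra.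
    assert (Hq : Rpower x t <= Rpower (1 + t + x) t) by (apply Rle_Rpower_l; lra).
    set (q := Rpower (1 + t + x) t) in *.
    assert (Hl' : (1 + x) * F * q <= (1 + t + x) * G).
    { apply Rmult_le_reg_r with (/ q); [apply Rinv_0_lt_compat; lra|].
      field_simplify; [|lra|lra].
      replace ((1 + t + x) * / q * G) with ((1 + t + x) * G / q) in Hl by (field; lra).
      replace ((x * F * q + F * q) / q) with ((1 + x) * F) by (field; lra). lra. }
    apply (Rle_div_r); [apply Rmult_lt_0_compat; assumption|].
    replace (/ (1 + / x)) with (x / (1 + x)) by (field; lra).
    apply Rmult_le_reg_l with (1 + t + x); [lra|].
    apply Rle_trans with ((1 + x) * F * Rpower x t).
    + replace ((1 + t + x) * (x / (1 + x) * (F * Rpower x t)))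
        with (((1 + t + x) * x / (1 + x)) * (F * Rpower x t)) by (field; lra).
      rewrite Rmult_assoc.
      apply Rmult_le_compat_r; [left; now apply Rmult_lt_0_compat|].
      apply Rle_div_l; [lra|]. nra.
    + eapply Rle_trans; [|exact Hl']. apply Rmult_le_compat_l; [|exact Hq]. nra.
  - apply Rle_div_l; [now apply Rmult_lt_0_compat|].
    replace (1 + t + x) with (1 + x + t) by ring.
    eapply Rle_trans; [apply (Gamma_add_le (1 + x) t); lra|]. rewrite EF.
    replace (Rpower (1 + x) t) with (Rpower x t * Rpower (1 + / x) t).
    + assert (Rpower (1 + / x) t <= 1 + / x).
      { assert (0 < / x) by (apply Rinv_0_lt_compat; lra).
        rewrite <- (Rpower_1 (1 + / x)) at 2 by lra. apply Rle_Rpower; lra. }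
      assert (0 < Rpower x t * F) by now apply Rmult_lt_0_compat. nra.
    + assert (0 < / x) by (apply Rinv_0_lt_compat; lra).
      rewrite Rpower_mult_distr by lra. f_equal. field. lra.
Qed.

(** The functional equation multiplies the ratio by [(1 + t + x) / x], which tends to 1. *)
Lemma gamma_ratio_lim_shift (t : R) : 0 <= t ->
  is_lim_seq (fun N => gamma_ratio t (S N)) 1 ->
  is_lim_seq (fun N => gamma_ratio (t + 1) (S N)) 1.
Proof.
  intros Ht H.
  apply (is_lim_seq_ext
    (fun N => gamma_ratio t (S N) * (1 + (1 + t) * / INR (S N)))).
  - intros N. unfold gamma_ratio. set (x := INR (S N)).
    assert (Hx : 1 <= x) by (unfold x; rewrite S_INR; pose proof (pos_INR N); lra).
    replace (1 + (t + 1) + x) with (1 + t + x + 1) by ring.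
    rewrite Gamma_succ, Rpower_plus, Rpower_1 by lra.
    assert (INR (fact (S N)) <> 0) by apply INR_fact_neq_0.
    assert (0 < Rpower x t) by apply exp_pos.
    field. lra.
  - replace (Finite 1) with (Finite (1 * (1 + (1 + t) * 0))) by (f_equal; ring).
    apply is_lim_seq_mult'; [exact H|].
    apply is_lim_seq_plus'; [apply is_lim_seq_const|].
    apply is_lim_seq_mult'; [apply is_lim_seq_const|apply is_lim_seq_inv_INR_S].
Qed.

Lemma gamma_ratio_lim (t : R) : 0 <= t ->
  is_lim_seq (fun N => gamma_ratio t (S N)) 1.
Proof.
  intros Ht. destruct (nfloor_ex t Ht) as [m Hm].
  replace t with (t - INR m + INR m) by ring.
  assert (H0 : 0 <= t - INR m <= 1) by lra.
  generalize (t - INR m) H0. clear. intros r Hr.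
  induction m as [|m IH].
  - simpl INR. rewrite Rplus_0_r. now apply gamma_ratio_lim_01.
  - rewrite S_INR, <- Rplus_assoc. pose proof (pos_INR m).
    apply gamma_ratio_lim_shift; [lra|exact IH].
Qed.

(** Euler's approximant of [1 / Gamma (1 + t)]. *)
Definition euler_coef (N : nat) (t : R) : R :=
  rising (1 + t) N / (INR (fact N) * Rpower (INR N) t).

Lemma euler_coef_lim (t : R) : 0 <= t ->
  is_lim_seq (fun N => euler_coef (S N) t) (/ Gamma (1 + t)).
Proof.
  intros Ht. pose proof (Gamma_pos (1 + t) ltac:(lra)) as HG.
  apply (is_lim_seq_ext (fun N => gamma_ratio t (S N) * / Gamma (1 + t))).
  - intros N. unfold gamma_ratio, euler_coef. rewrite Gamma_rising by exact Ht.
    assert (INR (fact (S N)) <> 0) by apply INR_fact_neq_0.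
    assert (0 < Rpower (INR (S N)) t) by apply exp_pos.
    field. lra.
  - replace (Finite (/ Gamma (1 + t))) with (Finite (1 * / Gamma (1 + t)))
      by (f_equal; ring).
    apply is_lim_seq_mult'; [now apply gamma_ratio_lim|apply is_lim_seq_const].
Qed.

Lemma euler_coef_pos (N : nat) (t : R) : 0 <= t -> 0 < euler_coef N t.
Proof.
  intros Ht. apply Rdiv_lt_0_compat; [apply rising_pos; lra|].
  apply Rmult_lt_0_compat; [apply lt_0_INR, lt_O_fact|apply exp_pos].
Qed.

(** The ratio of consecutive approximants is [(1 + t/(x+1)) (x/(x+1))^t]; by [1 + u <= e^u] the two
    factors are at most [exp (t/(x+1))] and [exp (- t/(x+1))]. This monotonicity later supplies the
    dominating series. *)
Lemma euler_coef_decr (N : nat) (t : R) : 0 <= t ->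
  euler_coef (S (S N)) t <= euler_coef (S N) t.
Proof.
  intros Ht. set (x := INR (S N)).
  assert (Hx : 1 <= x) by (unfold x; rewrite S_INR; pose proof (pos_INR N); lra).
  replace (euler_coef (S (S N)) t) with
    (euler_coef (S N) t * ((1 + t * / (x + 1)) * Rpower (x / (x + 1)) t)).
  - pose proof (euler_coef_pos (S N) t Ht).
    assert (Hv : 0 < / (x + 1)) by (apply Rinv_0_lt_compat; lra).
    assert (Hd : 0 < x / (x + 1)) by (apply Rdiv_lt_0_compat; lra).
    assert (Hle : (1 + t * / (x + 1)) * Rpower (x / (x + 1)) t <= 1).
    { apply Rle_trans with (exp (t * / (x + 1)) * exp (- (t * / (x + 1))));
        [|rewrite <- exp_plus, Rplus_opp_r, exp_0; lra].
      apply Rmult_le_compat.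
      - assert (0 <= t * / (x + 1)) by nra. lra.
      - left; apply exp_pos.
      - apply exp_ineq1_le.
      - pose proof (ln_le_minus_1 _ Hd) as Hln.
        replace (x / (x + 1) - 1) with (- / (x + 1)) in Hln by (field; lra).
        unfold Rpower.
        assert (Hm : t * ln (x / (x + 1)) <= - (t * / (x + 1))) by nra.
        destruct Hm as [Hm|Hm]; [left; now apply exp_increasing|right; now rewrite Hm]. }
    nra.
  - unfold euler_coef.
    change (rising (1 + t) (S (S N))) with (rising (1 + t) (S N) * (1 + t + x)).
    rewrite (fact_simpl (S N)), mult_INR, (S_INR (S N)). fold x.
    replace (Rpower x t) with (Rpower (x / (x + 1)) t * Rpower (x + 1) t).
    + assert (INR (fact (S N)) <> 0) by apply INR_fact_neq_0.
      assert (0 < Rpower (x + 1) t) by apply exp_pos.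
      assert (0 < Rpower (x / (x + 1)) t) by apply exp_pos.
      field. lra.
    + rewrite Rpower_mult_distr; [|apply Rdiv_lt_0_compat; lra|lra].
      f_equal. field. lra.
Qed.

Lemma euler_coef_le (N M : nat) (t : R) : 0 <= t ->
  euler_coef (S (N + M)) t <= euler_coef (S N) t.
Proof.
  intros Ht. induction M as [|M IH].
  - rewrite Nat.add_0_r. apply Rle_refl.
  - rewrite Nat.add_succ_r. eapply Rle_trans; [now apply euler_coef_decr|exact IH].
Qed.

Lemma inv_Gamma_le_euler_coef (N : nat) (t : R) : 0 <= t ->
  / Gamma (1 + t) <= euler_coef (S N) t.
Proof.
  intros Ht.
  apply (is_lim_seq_decr_compare (fun N => euler_coef (S N) t)).
  - now apply euler_coef_lim.
  - intros n. now apply euler_coef_decr.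
Qed.

(** * Dominated convergence for series *)

Lemma is_lim_seq_sum_n (u : nat -> nat -> R) (v : nat -> R) (K : nat) :
  (forall n, is_lim_seq (fun N => u N n) (v n)) ->
  is_lim_seq (fun N => sum_n (u N) K) (sum_n v K).
Proof.
  intros H. induction K as [|K IH].
  - rewrite sum_O. apply (is_lim_seq_ext (fun N => u N O)); [|apply H].
    intros N. now rewrite sum_O.
  - rewrite sum_Sn. apply (is_lim_seq_ext (fun N => sum_n (u N) K + u N (S K))).
    + intros N. now rewrite sum_Sn.
    + apply is_lim_seq_plus'; [exact IH|apply H].
Qed.

Lemma Series_tail (u : nat -> R) (K : nat) : ex_series u ->
  Series u = sum_n u K + Series (fun k => u (S K + k)%nat).
Proof.
  intros Hu. rewrite (Series_incr_n u (S K)); [|lia|exact Hu].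
  now rewrite sum_n_Reals.
Qed.

(** Cut where the tail of [w] falls below [eps / 2]; the finite head tends to 0 termwise. *)
Lemma Series_dominated_0 (u : nat -> nat -> R) (w : nat -> R) :
  (forall N n, 0 <= u N n <= w n) -> ex_series w ->
  (forall n, is_lim_seq (fun N => u N n) 0) ->
  is_lim_seq (fun N => Series (u N)) 0.
Proof.
  intros Hb Hw Hl.
  assert (Hu : forall N, ex_series (u N)).
  { intros N. apply (ex_series_le (V := R_CompleteNormedModule) (u N) w); [|exact Hw].
    intros n. unfold norm; simpl; unfold abs; simpl.
    rewrite Rabs_pos_eq; apply Hb. }
  apply is_lim_seq_spec. intros eps.
  assert (He : 0 < eps / 2) by (pose proof (cond_pos eps); lra).
  assert (Hs : is_lim_seq (sum_n w) (Series w)) by (apply Series_correct; exact Hw).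
  apply is_lim_seq_spec in Hs. destruct (Hs (mkposreal _ He)) as [K HK].
  specialize (HK K (le_n K)). simpl in HK. apply Rabs_def2 in HK.
  pose proof (is_lim_seq_sum_n u (fun _ => 0) K Hl) as Hsum.
  rewrite sum_n_const, Rmult_0_r in Hsum.
  apply is_lim_seq_spec in Hsum. destruct (Hsum (mkposreal _ He)) as [N0 HN0].
  exists N0. intros N HN. specialize (HN0 N HN). simpl in HN0.
  rewrite Rminus_0_r in *. apply Rabs_def2 in HN0.
  rewrite Rabs_pos_eq by (apply Series_nonneg; [apply Hu|apply Hb]).
  rewrite (Series_tail (u N) K (Hu N)).
  rewrite (Series_tail w K Hw) in HK.
  assert (Series (fun k => u N (S K + k)%nat) <= Series (fun k => w (S K + k)%nat)).
  { apply Series_le; [intros n; apply Hb|]. now apply (ex_series_incr_n w (S K)). }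
  lra.
Qed.

(** The differences [|u N n - v n|] are dominated by [2 * w n] and tend to 0. *)
Lemma Series_dominated (u : nat -> nat -> R) (v w : nat -> R) :
  (forall N n, Rabs (u N n) <= w n) -> (forall n, Rabs (v n) <= w n) -> ex_series w ->
  (forall n, is_lim_seq (fun N => u N n) (v n)) ->
  is_lim_seq (fun N => Series (u N)) (Series v).
Proof.
  intros Hu Hv Hw Hl.
  assert (Hex : forall z, (forall n, Rabs (z n) <= w n) -> ex_series z).
  { intros z Hz. now apply (ex_series_le (V := R_CompleteNormedModule) z w). }
  assert (Hd : is_lim_seq (fun N => Series (fun n => Rabs (u N n - v n))) 0).
  { apply (Series_dominated_0 _ (fun n => w n + w n)).
    - intros N n. split; [apply Rabs_pos|].
      eapply Rle_trans; [apply Rabs_triang|]. rewrite Rabs_Ropp.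
      apply Rplus_le_compat; auto.
    - now apply (ex_series_plus (V := R_NormedModule)).
    - intros n. rewrite <- Rabs_R0. apply (is_lim_seq_abs _ 0).
      replace (Finite 0) with (Finite (v n - v n)) by (f_equal; ring).
      apply is_lim_seq_minus'; [apply Hl|apply is_lim_seq_const]. }
  apply (is_lim_seq_ext (fun N => Series v + Series (fun n => u N n - v n))).
  { intros N. rewrite Series_minus; [ring|apply Hex; apply Hu|now apply Hex]. }
  replace (Finite (Series v)) with (Finite (Series v + 0)) by (f_equal; ring).
  apply is_lim_seq_plus'; [apply is_lim_seq_const|].
  apply is_lim_seq_abs_0.
  apply (is_lim_seq_le_le (fun _ => 0) _
    (fun N => Series (fun n => Rabs (u N n - v n)))); [|apply is_lim_seq_const|exact Hd].
  intros N. split; [apply Rabs_pos|]. apply Series_Rabs.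
  apply (ex_series_le (V := R_CompleteNormedModule) _ (fun n => w n + w n)).
  - intros n. unfold norm; simpl; unfold abs; simpl. rewrite Rabs_Rabsolu.
    eapply Rle_trans; [apply Rabs_triang|]. rewrite Rabs_Ropp.
    apply Rplus_le_compat; auto.
  - now apply (ex_series_plus (V := R_NormedModule)).
Qed.

(** * Monotonicity *)

(* Up to the factor [s^(-N-1) N!], the [n]-th term of the [(N+1)]-st derivative of
   [1/(1 - s^(-a))], with sign removed, at the Post-Widder point [s = N/x]. *)
Definition widder_term (a x : R) (N n : nat) : R :=
  INR n * a * euler_coef N (INR n * a) * Rpower x a ^ n.

Lemma INR_mult_nonneg (n : nat) (a : R) : 0 < a -> 0 <= INR n * a.
Proof. intros Ha. apply Rmult_le_pos; [apply pos_INR|lra]. Qed.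

(** At [s = S N / x], the power [s^(-na)] is [x^(na) / (S N)^(na)], whose denominator is the one in
    [euler_coef]. The first Pochhammer factor [n a] splits off, so the order of differentiation
    exceeds the Euler index by one. *)
Lemma rising_coef_widder (a x : R) (N n : nat) : 0 < x ->
  rising (INR n * a) (S (S N)) * Rpower (INR (S N) / x) (- a) ^ n =
  INR (fact (S N)) * widder_term a x (S N) n.
Proof.
  intros Hx. unfold widder_term, euler_coef. set (y := INR (S N)).
  assert (Hy : 0 < y) by (apply lt_0_INR; lia).
  assert (E : Rpower (y / x) (- a) = Rpower x a / Rpower y a).
  { unfold Rdiv. rewrite <- !Rpower_Ropp, <- Rpower_mult_distr;
      [|exact Hy|now apply Rinv_0_lt_compat].
    rewrite <- (Rpower_1 x) at 1 by exact Hx.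
    rewrite <- Rpower_Ropp, Rpower_mult. rewrite Rmult_comm. f_equal. f_equal. ring. }
  rewrite E. unfold Rdiv at 1. rewrite Rpow_mult_distr, pow_inv.
  assert (E2 : Rpower y (INR n * a) = Rpower y a ^ n).
  { rewrite <- (Rpower_pow n) by apply exp_pos. rewrite Rpower_mult. f_equal. ring. }
  rewrite E2, rising_shift. rewrite (Rplus_comm (INR n * a) 1).
  assert (INR (fact (S N)) <> 0) by apply INR_fact_neq_0.
  assert (Rpower y a ^ n <> 0) by (apply pow_nonzero, Rgt_not_eq, exp_pos).
  field. now split.
Qed.

(** The condition [x < S N] places the Post-Widder point beyond 1, hence [s^(-a)] inside the disc of
    convergence. *)
Lemma ex_series_widder (a x : R) (N : nat) : 0 < a -> 0 < x -> x < INR (S N) ->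
  ex_series (widder_term a x (S N)).
Proof.
  intros Ha Hx HN.
  assert (Hs : 1 < INR (S N) / x) by (apply (Rlt_div_r 1); lra).
  pose proof (CV_radius_inside _ _ (rising_coef_inside a _ (S (S N)) Ha Hs)) as H.
  apply ex_pseries_R in H.
  apply (ex_series_ext (fun n => / INR (fact (S N)) *
    (rising (INR n * a) (S (S N)) * Rpower (INR (S N) / x) (- a) ^ n))).
  - intros n. rewrite rising_coef_widder, <- Rmult_assoc, Rinv_l by
      (exact Hx || apply INR_fact_neq_0). apply Rmult_1_l.
  - now apply (ex_series_scal_l (K := R_AbsRing) (V := R_NormedModule)
                 (/ INR (fact (S N)))).
Qed.

Lemma widder_term_nonneg (a x : R) (N n : nat) : 0 < a -> 0 <= widder_term a x N n.
Proof.
  intros Ha. unfold widder_term. pose proof (INR_mult_nonneg n a Ha).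
  apply Rmult_le_pos; [apply Rmult_le_pos; [exact H|]|apply pow_le; left; apply exp_pos].
  left. now apply euler_coef_pos.
Qed.

Lemma Series_widder_le (a b x : R) (N : nat) : 0 < a -> a < b ->
  (b <= 1 \/ (1 <= a /\ b <= 2)) -> 0 < x -> x < INR (S N) ->
  Series (widder_term b x (S N)) <= Series (widder_term a x (S N)).
Proof.
  intros Ha Hab Hcase Hx HN.
  assert (Hs : 1 < INR (S N) / x) by (apply (Rlt_div_r 1); lra).
  set (s := INR (S N) / x) in *.
  pose proof (cm_derivatives_nonneg (fun k s => geom_deriv a k s - geom_deriv b k s)) as H.
  assert (H0 : 0 <= geom_deriv a (S (S N)) s - geom_deriv b (S (S N)) s).
  { rewrite <- (Nat.add_0_r (S (S N))). apply H; [| |exact Hs].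
    - intros k y Hy.
      replace (- (geom_deriv a (S k) y - geom_deriv b (S k) y)) with
        (- geom_deriv a (S k) y - - geom_deriv b (S k) y) by ring.
      apply (is_derive_minus (geom_deriv a k) (geom_deriv b k));
        apply geom_deriv_derive; lra.
    - eapply cm_ext; [|exact (cm_geometric_gap (S (S N)) a b Ha Hab Hcase)].
      intros y Hy. cbv beta. rewrite !geom_deriv_0 by lra. reflexivity. }
  (* The positive prefactor does not depend on the exponent [c], so it cancels from the
     comparison. *)
  assert (E : forall c, geom_deriv c (S (S N)) s =
    Rpower s (- INR (S (S N))) * INR (fact (S N)) * Series (widder_term c x (S N))).
  { intros c. unfold geom_deriv, PSeries. rewrite Rmult_assoc.
    rewrite <- (Series_scal_l (INR (fact (S N)))). f_equal. apply Series_ext. intros n. now apply rising_coef_widder. }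
  rewrite !E in H0.
  assert (0 < Rpower s (- INR (S (S N))) * INR (fact (S N))).
  { apply Rmult_lt_0_compat; [apply exp_pos|apply lt_0_INR, lt_O_fact]. }
  nra.
Qed.

(** * The Mittag-Leffler function as a power series *)

Definition ml_coef (a : R) (n : nat) : R := / Gamma (1 + INR n * a).

Lemma ml_coef_pos (a : R) (n : nat) : 0 < a -> 0 < ml_coef a n.
Proof.
  intros Ha. apply Rinv_0_lt_compat, Gamma_pos.
  pose proof (INR_mult_nonneg n a Ha). lra.
Qed.

Lemma MittagLeffler_PSeries (a z : R) : MittagLeffler a z = PSeries (ml_coef a) z.
Proof.
  apply Series_ext. intros n. unfold ml_coef, Rdiv. apply Rmult_comm.
Qed.

Lemma ml_term_le_widder (a x : R) (N n : nat) : 0 < a ->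
  INR n * a * ml_coef a n * Rpower x a ^ n <= widder_term a x (S N) n.
Proof.
  intros Ha. pose proof (INR_mult_nonneg n a Ha).
  apply Rmult_le_compat_r; [apply pow_le; left; apply exp_pos|].
  apply Rmult_le_compat_l; [exact H|]. now apply inv_Gamma_le_euler_coef.
Qed.

(** Any [z > 0] is [x^a] for some [x]. A Widder series with [S N > x] converges and its terms
    dominate [n a z^n / Gamma (1 + n a)], so these stay bounded and the radius is at least [z]. *)
Lemma CV_radius_ml_coef (a : R) : 0 < a -> CV_radius (ml_coef a) = p_infty.
Proof.
  intros Ha. rewrite <- CV_radius_INR_mult.
  destruct (CV_radius_bounded (fun n => INR n * ml_coef a n)) as [Hub _].
  assert (Hall : forall z, 0 < z -> Rbar_le z (CV_radius (fun n => INR n * ml_coef a n))).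
  { intros z Hz. apply Hub.
    set (x := Rpower z (/ a)).
    assert (Hx : 0 < x) by apply exp_pos.
    assert (Exz : Rpower x a = z).
    { unfold x. rewrite Rpower_mult, Rinv_l, Rpower_1; lra. }
    destruct (nfloor_ex x (Rlt_le _ _ Hx)) as [N [_ HN]]. rewrite <- S_INR in HN.
    pose proof (ex_series_lim_0 _ (ex_series_widder a x N Ha Hx HN)) as Hlim.
    destruct (filterlim_bounded (V := R_NormedModule) (widder_term a x (S N)))
      as [M HM]; [now exists 0|].
    exists (M / a). intros n. apply Rle_div_r; [lra|].
    apply Rle_trans with (widder_term a x (S N) n); [|].
    - rewrite Rabs_pos_eq.
      + eapply Rle_trans; [|apply (ml_term_le_widder a x N n Ha)].
        rewrite Exz. right. ring.
      + apply Rmult_le_pos; [|apply pow_le; lra].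
        apply Rmult_le_pos; [apply pos_INR|left; now apply ml_coef_pos].
    - specialize (HM n). unfold norm in HM; simpl in HM; unfold abs in HM; simpl in HM.
      eapply Rle_trans; [apply Rle_abs|exact HM]. }
  destruct (CV_radius (fun n => INR n * ml_coef a n)) as [r| |]; [|reflexivity|].
  - exfalso. pose proof (Hall (Rabs r + 1)) as Hr. simpl in Hr.
    pose proof (Rabs_pos r). pose proof (Rle_abs r). specialize (Hr ltac:(lra)). lra.
  - exfalso. exact (Hall 1 Rlt_0_1).
Qed.

Lemma ml_coef_inside (a z : R) : 0 < a -> Rbar_lt (Rabs z) (CV_radius (ml_coef a)).
Proof. intros Ha. now rewrite CV_radius_ml_coef. Qed.

(** The terms decrease as the index grows, so the series at [N0] dominates all later ones and
    Euler's limit passes to the sum. The limit is [x] times the derivative of [x |-> E_a (x^a)]. *)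
Lemma Series_widder_lim (a x : R) (N0 : nat) : 0 < a -> 0 < x -> x < INR (S N0) ->
  is_lim_seq (fun N => Series (widder_term a x (S (N0 + N))))
    (a * PSeries (fun n => INR n * ml_coef a n) (Rpower x a)).
Proof.
  intros Ha Hx HN0. unfold PSeries. rewrite <- Series_scal_l.
  apply (Series_dominated (fun N => widder_term a x (S (N0 + N))) _
           (widder_term a x (S N0))).
  - intros N n. rewrite Rabs_pos_eq by now apply widder_term_nonneg.
    pose proof (INR_mult_nonneg n a Ha).
    apply Rmult_le_compat_r; [apply pow_le; left; apply exp_pos|].
    apply Rmult_le_compat_l; [exact H|]. now apply euler_coef_le.
  - intros n.
    replace (a * (INR n * ml_coef a n * Rpower x a ^ n)) with
      (INR n * a * ml_coef a n * Rpower x a ^ n) by ring.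
    rewrite Rabs_pos_eq; [now apply ml_term_le_widder|].
    apply Rmult_le_pos; [|apply pow_le; left; apply exp_pos].
    apply Rmult_le_pos; [now apply INR_mult_nonneg|left; now apply ml_coef_pos].
  - now apply ex_series_widder.
  - intros n. unfold widder_term.
    replace (a * (INR n * ml_coef a n * Rpower x a ^ n)) with
      (INR n * a * ml_coef a n * Rpower x a ^ n) by ring.
    apply is_lim_seq_mult'; [|apply is_lim_seq_const].
    apply is_lim_seq_mult'; [apply is_lim_seq_const|].
    apply (is_lim_seq_ext (fun N => euler_coef (S (N + N0)) (INR n * a))).
    { intros N. now rewrite Nat.add_comm. }
    apply (is_lim_seq_incr_n (fun N => euler_coef (S N) (INR n * a)) N0).
    apply euler_coef_lim. now apply INR_mult_nonneg.
Qed.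

Lemma ml_derivative_le (a b x : R) : 0 < a -> a < b ->
  (b <= 1 \/ (1 <= a /\ b <= 2)) -> 0 < x ->
  b * PSeries (fun n => INR n * ml_coef b n) (Rpower x b) <=
  a * PSeries (fun n => INR n * ml_coef a n) (Rpower x a).
Proof.
  intros Ha Hab Hcase Hx.
  destruct (nfloor_ex x (Rlt_le _ _ Hx)) as [N0 [_ HN0]]. rewrite <- S_INR in HN0.
  refine (is_lim_seq_le _ _ (Finite _) (Finite _) _
           (Series_widder_lim b x N0 _ Hx HN0) (Series_widder_lim a x N0 Ha Hx HN0)); [|lra].
  intros N. apply Series_widder_le; try assumption.
  eapply Rlt_le_trans; [exact HN0|]. apply le_INR. lia.
Qed.

Lemma ml_gap_nondecreasing (a b y x : R) : 0 < a -> a < b ->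
  (b <= 1 \/ (1 <= a /\ b <= 2)) -> 0 < y -> y <= x ->
  MittagLeffler a (Rpower y a) - MittagLeffler b (Rpower y b) <=
  MittagLeffler a (Rpower x a) - MittagLeffler b (Rpower x b).
Proof.
  intros Ha Hab Hcase Hy Hyx. rewrite !MittagLeffler_PSeries.
  set (d := fun c t => c / t * PSeries (fun n => INR n * ml_coef c n) (Rpower t c)).
  apply (nonneg_derive_le
    (fun t => PSeries (ml_coef a) (Rpower t a) - PSeries (ml_coef b) (Rpower t b))
    (fun t => d a t - d b t)); [exact Hyx| |].
  - intros t Ht.
    apply (is_derive_minus (fun t => PSeries (ml_coef a) (Rpower t a))
             (fun t => PSeries (ml_coef b) (Rpower t b)));
      apply PSeries_Rpower_derive; try lra; apply ml_coef_inside; lra.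
  - intros t Ht. unfold d.
    pose proof (ml_derivative_le a b t Ha Hab Hcase ltac:(lra)).
    assert (0 < / t) by (apply Rinv_0_lt_compat; lra).
    unfold Rdiv.
    replace (a * / t * PSeries (fun n => INR n * ml_coef a n) (Rpower t a) -
             b * / t * PSeries (fun n => INR n * ml_coef b n) (Rpower t b)) with
      (/ t * (a * PSeries (fun n => INR n * ml_coef a n) (Rpower t a) -
              b * PSeries (fun n => INR n * ml_coef b n) (Rpower t b))) by ring.
    apply Rmult_le_pos; lra.
Qed.

(** * Comparison near zero and conclusion *)

Definition ml_quotient (a z : R) : R := PSeries (PS_decr_1 (ml_coef a)) z.

(** The constant term is 1 for every [a], so a comparison near zero concerns only
    [(E_a(z) - 1) / z], a power series with positive coefficients. *)
Lemma MittagLeffler_quotient (a z : R) : 0 < a ->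
  MittagLeffler a z = 1 + z * ml_quotient a z.
Proof.
  intros Ha. rewrite MittagLeffler_PSeries, PSeries_decr_1.
  - unfold ml_coef at 1. simpl INR. rewrite Rmult_0_l, Rplus_0_r, Gamma_1, Rinv_1.
    reflexivity.
  - apply CV_radius_inside. now apply ml_coef_inside.
Qed.

Lemma ex_series_ml_quotient (a z : R) : 0 < a ->
  ex_series (fun n => PS_decr_1 (ml_coef a) n * z ^ n).
Proof.
  intros Ha. apply ex_pseries_R, CV_radius_inside.
  rewrite CV_radius_decr_1. now apply ml_coef_inside.
Qed.

Lemma ml_quotient_le (a y z : R) : 0 < a -> 0 <= y -> y <= z ->
  ml_quotient a y <= ml_quotient a z.
Proof.
  intros Ha Hy Hyz. apply Series_le; [|now apply ex_series_ml_quotient].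
  intros n. pose proof (ml_coef_pos a (S n) Ha) as H. unfold PS_decr_1. split.
  - apply Rmult_le_pos; [lra|now apply pow_le].
  - apply Rmult_le_compat_l; [lra|]. now apply pow_incr.
Qed.

Lemma ml_quotient_0 (a : R) : ml_quotient a 0 = ml_coef a 1.
Proof. unfold ml_quotient. now rewrite PSeries_0. Qed.

(** With [e = 1 / Gamma (1 + a)], [E_a (y^a) - 1] is at least [e y^a], while [E_b (y^b) - 1] is at
    most [C y^a y^(b-a)], which is smaller once [y^(b-a)] is small. *)
Lemma ml_gap_pos_near_0 (a b x : R) : 0 < a -> a < b -> 0 < x ->
  exists y, 0 < y <= x /\
    MittagLeffler b (Rpower y b) < MittagLeffler a (Rpower y a).
Proof.
  intros Ha Hab Hx.
  assert (Hb : 0 < b) by lra.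
  pose proof (ml_coef_pos a 1 Ha) as Hea. rewrite <- ml_quotient_0 in Hea.
  pose proof (ml_coef_pos b 1 Hb) as Heb. rewrite <- ml_quotient_0 in Heb.
  assert (HpC : 0 < Rpower x b) by apply exp_pos.
  pose proof (ml_quotient_le b 0 (Rpower x b) Hb (Rle_refl 0) (Rlt_le _ _ HpC)) as HC.
  set (C := ml_quotient b (Rpower x b)) in *. set (e := ml_quotient a 0) in *.
  (* Half of the threshold [e / C], so that the final inequality is strict. *)
  set (r := e / (2 * C)).
  assert (Hr : 0 < r) by (apply Rdiv_lt_0_compat; lra).
  (* [w] solves [w^(b-a) = r]; taking [y <= x] as well keeps [C] a valid bound. *)
  set (w := Rpower r (/ (b - a))). assert (Hw : 0 < w) by apply exp_pos.
  set (y := Rmin x w).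
  assert (Hy : 0 < y) by now apply Rmin_glb_lt.
  assert (Hyx : y <= x) by apply Rmin_l. assert (Hyw : y <= w) by apply Rmin_r.
  exists y. split; [split; assumption|].
  rewrite !MittagLeffler_quotient by assumption.
  assert (Hya : 0 < Rpower y a) by apply exp_pos.
  assert (Hyc : 0 < Rpower y (b - a)) by apply exp_pos.
  assert (E : Rpower y b = Rpower y a * Rpower y (b - a)).
  { rewrite <- Rpower_plus. f_equal. ring. }
  assert (H1 : e <= ml_quotient a (Rpower y a)) by (apply ml_quotient_le; lra).
  assert (H2 : ml_quotient b (Rpower y b) <= C).
  { apply ml_quotient_le; [exact Hb|left; apply exp_pos|]. apply Rle_Rpower_l; lra. }
  assert (H3 : Rpower y (b - a) <= r).
  { replace r with (Rpower w (b - a)).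
    - apply Rle_Rpower_l; lra.
    - unfold w. rewrite Rpower_mult, Rinv_l, Rpower_1; lra. }
  assert (H4 : r * C = e / 2) by (unfold r; field; lra).
  assert (H5 : Rpower y (b - a) * ml_quotient b (Rpower y b) < ml_quotient a (Rpower y a)).
  { apply Rle_lt_trans with (Rpower y (b - a) * C); [apply Rmult_le_compat_l; lra|].
    apply Rle_lt_trans with (r * C); [apply Rmult_le_compat_r; lra|lra]. }
  rewrite E at 1. rewrite Rmult_assoc. apply Rplus_lt_compat_l.
  now apply Rmult_lt_compat_l.
Qed.

Lemma MittagLeffler_decr (a b x : R) : 0 < x -> 0 < a -> a < b ->
  (b <= 1 \/ (1 <= a /\ b <= 2)) ->
  MittagLeffler b (Rpower x b) < MittagLeffler a (Rpower x a).
Proof.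
  intros Hx Ha Hab Hcase.
  destruct (ml_gap_pos_near_0 a b x Ha Hab Hx) as [y [Hy Hlt]].
  pose proof (ml_gap_nondecreasing a b y x Ha Hab Hcase (proj1 Hy) (proj2 Hy)). lra.
Qed.

Theorem theoremA :
  forall x : R, 0 < x ->
  forall a b : R, 0 < a -> a < b -> b < 2 ->
    MittagLeffler b (Rpower x b) < MittagLeffler a (Rpower x a).
Proof.
  intros x Hx a b Ha Hab Hb.
  destruct (Rle_lt_dec b 1) as [Hb1|Hb1]; [apply MittagLeffler_decr; tauto|].
  destruct (Rle_lt_dec 1 a) as [Ha1|Ha1]; [apply MittagLeffler_decr; lra|].
  (* For [a < 1 < b] neither factorization applies, so the exponent 1 serves as an intermediate
     point. *)
  apply Rlt_trans with (MittagLeffler 1 (Rpower x 1)); apply MittagLeffler_decr; lra.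
Qed.
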